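(* Let $X$ be a real Banach space and let $A\colon X\rightrightarrows X^*$ be maximally monotone such that $\operatorname{int}\operatorname{dom}A\neq\varnothing$. Then $\operatorname{gra}A$ is norm $\times$ weak$^*$ closed, i.e. closed in $X\times X^*$ for the product of the norm topology on $X$ and the weak$^*$ topology on $X^*$.
   Context: $X$ is a real Banach space with continuous dual $X^*$ and pairing $\langle\cdot,\cdot\rangle$. A set-valued operator $A\colon X\rightrightarrows X^*$ assigns to each $x\in X$ a (possibly empty) set $Ax\subseteq X^*$; $\operatorname{gra}A=\{(x,x^* )\in X\times X^*\mid x^*\in Ax\}$ and $\operatorname{dom}A=\{x\mid Ax\neq\varnothing\}$. $A$ is monotone if $\langle x-y,x^*-y^*\rangle\ge0$ for all $(x,x^* ),(y,y^* )\in\operatorname{gra}A$, and maximally monotone if it is monotone and has no proper monotone extension (in the sense of graph inclusion). *)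

(* Defs.v *)
From HB Require Import structures.
From mathcomp Require Import all_boot all_order all_algebra.
From mathcomp Require Import all_classical all_reals.
From mathcomp Require Import topology normedtype.

Set Implicit Arguments.
Unset Strict Implicit.
Unset Printing Implicit Defensive.
Import Order.TTheory GRing.Theory Num.Theory numFieldNormedType.Exports.
Local Open Scope classical_set_scope.
Local Open Scope ring_scope.

Section Dual.
Context {R : realType} (X : normedModType R).

Definition continuous_functional : {pred X -> R^o} :=
  mem [set f : X -> R^o | linear f /\ continuous f].

Lemma continuous_functional_submod : submod_closed continuous_functional.
Proof.
split=> [|a f g /set_mem[lf cf] /set_mem[lg cg]]; apply/mem_set; split.
- by move=> b x y; rewrite /= scaler0 addr0.
- by move=> x; exact: cvg_cst.
- move=> b x y.
  have E z : (a *: f + g) z = a *: f z + g z by [].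
  by rewrite !E lf lg !scalerDr addrACA !scalerA (mulrC a).
- move=> x; apply: (@cvgD _ _ _ (nbhs x) _ (fun z => a *: f z) g).
    by apply: cvgZl_tmp; exact: cf.
  exact: cg.
Qed.

HB.instance Definition _ := GRing.isSubmodClosed.Build R (X -> R^o)
  continuous_functional continuous_functional_submod.

(* The continuous dual as a vector space; it carries no topology by itself. *)
Record dual := Dual {
  dual_fun :> X -> R^o;
  dual_funP : dual_fun \in continuous_functional }.

HB.instance Definition _ := [isSub for dual_fun].
HB.instance Definition _ := [Choice of dual by <:].
HB.instance Definition _ := [SubChoice_isSubLmodule of dual by <:].

Definition pairing (x : X) (f : dual) : R := f x.

(* The same carrier, with the topology of pointwise convergence on X: the
   coarsest one making every evaluation f |-> pairing x f continuous. *)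
Definition weak_star : Type :=
  initial_topology (fun f : dual => (f : X -> R^o) : {ptws X -> R^o}).
HB.instance Definition _ := Topological.on weak_star.

End Dual.

Section Operators.
Context {R : realType} {X : normedModType R}.
Implicit Types A : X -> set (dual X).

Definition gra A : set (X * dual X) := [set p | A p.1 p.2].

Definition dom A : set X := [set x | A x !=set0].

Definition monotone A : Prop :=
  forall x xs y ys, gra A (x, xs) -> gra A (y, ys) ->
  0 <= pairing (x - y) (xs - ys).

Definition maximally_monotone A : Prop :=
  monotone A /\ ~ exists B, monotone B /\ gra A `<` gra B.

End Operators.

(* Main.v *)
Require Import Defs.
From mathcomp Require Import all_boot all_order all_algebra.
From mathcomp Require Import all_classical all_reals.
From mathcomp Require Import topology normedtype.
From mathcomp Require Import sequences lra.
Import Order.TTheory GRing.Theory Num.Theory.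
Import numFieldNormedType.Exports.
Local Open Scope classical_set_scope.
Local Open Scope ring_scope.

(** A norm-to-weak* limit (a, as) of points of gra A lies in gra A as soon as
    it is monotonically related to gra A (lemma [maximally_monotone_related]).
    For (y, ys) in gra A, monotonicity at the approximating points (b, bs) reads
    0 <= <b - a, bs> + <a - y, bs> - <b - y, ys>,
    where the last two terms converge to <a - y, as> - <a - y, ys>.  The
    difficulty is the term <b - a, bs>: a weak*-convergent net may be unbounded,
    so b -> a does not by itself make it small.

    The interior of the domain supplies the missing bound.  If y is in dom A and
    ys is in A y, then <y - b, bs> <= <y - b, ys>, so <y - b, bs> is bounded above
    for all (b, bs) in gra A with b close to a.  The sets of those y for which a
    given bound holds are closed, and countably many of them cover dom A; by
    Baire's theorem one of them contains a ball around some x0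
    ([ball_pairing_bounded]).  Hence <u, bs> <= c + <b - x0, bs> for all small u.
    Since <a - x0, bs> converges, taking u to be a large multiple of b - a gives
    limsup <b - a, bs> <= 0 ([pairing_graph_near_le]): the term <b - a, bs>
    produced on the right-hand side is absorbed on the left. *)

Section Pairing.
Context {R : realType} {X : normedModType R}.
Implicit Types (x y : X) (f g : dual X).

Lemma pairing_linear f : linear (fun x => pairing x f : R^o).
Proof. by have /set_mem[] := dual_funP f. Qed.

Lemma pairingDl x y f : pairing (x + y) f = pairing x f + pairing y f.
Proof. by have := pairing_linear f 1 x y; rewrite !scale1r. Qed.

Lemma pairingZl a x f : pairing (a *: x) f = a * pairing x f.
Proof.
have P0 : pairing 0 f = 0.
  by apply: (@addrI _ (pairing 0 f)); rewrite -pairingDl !addr0.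
by have := pairing_linear f a x 0; rewrite P0 !addr0.
Qed.

Lemma pairingBl x y f : pairing (x - y) f = pairing x f - pairing y f.
Proof. by rewrite -scaleN1r pairingDl pairingZl mulN1r. Qed.

Lemma pairingBr x f g : pairing x (f - g) = pairing x f - pairing x g.
Proof. by []. Qed.

Lemma pairing_continuous f : continuous (fun x => pairing x f : R^o).
Proof. by have /set_mem[] := dual_funP f. Qed.

Lemma weak_star_pairing_continuous x :
  continuous (fun f : weak_star X => pairing x f : R^o).
Proof.
move=> f.
have := @proj_continuous X (fun=> R^o : topologicalType) x (f : X -> R^o).
apply: (@continuous_comp (weak_star X) {ptws X -> R^o} R^o
  (fun f : dual X => (f : X -> R^o) : {ptws X -> R^o})).
exact: initial_continuous.
Qed.

End Pairing.

Lemma near_fst {T U : topologicalType} (x : T) (y : U) (P : set T) :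
  (\forall t \near x, P t) -> \forall p \near (x, y), P p.1.
Proof. exact: (@cvg_fst _ _ (nbhs x) (nbhs y)). Qed.

Lemma near_snd {T U : topologicalType} (x : T) (y : U) (P : set U) :
  (\forall u \near y, P u) -> \forall p \near (x, y), P p.2.
Proof. exact: (@cvg_snd _ _ (nbhs x) (nbhs y)). Qed.

(** Otherwise adding the point to the graph would give a proper monotone
    extension. *)
Lemma maximally_monotone_related {R : realType} {X : normedModType R}
    {A : X -> set (dual X)} (a : X) (f : dual X) :
  maximally_monotone A ->
  (forall y g, gra A (y, g) -> 0 <= pairing (a - y) (f - g)) ->
  gra A (a, f).
Proof.
move=> [monA maxA] rel; apply: contrapT => nAaf; apply: maxA.
have pairing_sym x y (g h : dual X) :
    pairing (x - y) (g - h) = pairing (y - x) (h - g).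
  by rewrite !pairingBr !pairingBl; lra.
exists (fun x => A x `|` [set g | x = a /\ g = f]); split; last first.
  split=> [p Ap|]; first by left.
  by move=> /(_ (a, f)) H; apply: nAaf; apply: H; right.
move=> x g y h [Axg|/= [-> ->]] [Ayh|/= [-> ->]].
- exact: monA.
- by have := rel _ _ Axg; rewrite pairing_sym.
- exact: rel.
- by rewrite subrr.
Qed.

(** Baire's theorem applied to closed sets [F n] covering [dom A].  The integer
    [n] bounds the pairing from above and the radius around [a] by
    [n.+1%:R^-1]: a functional [g] in [A y] is bounded on a small enough ball
    around [a] by continuity, and monotonicity transfers its bound to all the
    functionals at points of that ball, which puts [y] in some [F n]. *)
Lemma ball_pairing_bounded {R : realType} {X : completeNormedModType R}
    {A : X -> set (dual X)} (a : X) :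
  monotone A -> (dom A)° !=set0 ->
  exists x0 d r c, [/\ 0 < d, 0 < r &
    forall y b f, ball x0 d y -> ball a r b -> gra A (b, f) ->
      pairing (y - b) f <= c].
Proof.
move=> monA domA.
pose F n := [set y : X | forall b f, ball a n.+1%:R^-1 b -> gra A (b, f) ->
  pairing (y - b) f <= n%:R].
have closedF n : closed (F n).
  have -> : F n = \bigcap_(p in [set p | ball a n.+1%:R^-1 p.1 /\ gra A p])
      [set y : X | pairing (y - p.1) p.2 <= n%:R].
    apply/seteqP; split=> [y Fy [b f] [/= ab Abf]|y Fy b f ab Abf].
      exact: Fy.
    exact: (Fy (b, f)).
  apply: closed_bigI => -[b f] _ /=.
  rewrite (_ : [set _ | _] =
      (fun y => pairing y f : R^o) @^-1` [set t | t <= n%:R + pairing b f]).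
    apply: closed_comp; last exact: closed_le.
    by move=> x _; exact: pairing_continuous.
  by apply/seteqP; split=> y /=; rewrite pairingBl lerBlDr.
have domF y : dom A y -> exists n, F n y.
  move=> [g Ayg].
  have : \forall b \near a, `|pairing a g - pairing b g| < 1.
    exact: (cvgr_dist_lt _ _ (pairing_continuous g a) _ ltr01).
  move=> /nbhs_ballP[e /= e0 He].
  (* The last summand makes [n.+1%:R^-1 <= e], the others bound [<y - b, g>]. *)
  pose s := `|pairing (y - a) g| + 1 + e^-1.
  have s0 : 0 <= s by rewrite /s !addr_ge0// invr_ge0 ltW.
  have [n sn] : exists n, s <= n%:R.
    by exists (Num.bound s); exact/ltW/archi_boundP.
  exists n => b f ab Abf.
  have {}ab : ball a e b.
    apply: le_ball ab.
    rewrite -[leRHS]invrK lef_pV2 ?posrE ?invr_gt0 ?ltr0n//.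
    have := normr_ge0 (pairing (y - a) g).
    by move: sn; rewrite /s -natr1; lra.
  have := He _ ab; rewrite /= ltr_norml => /andP[_ H1].
  have := monA _ _ _ _ Ayg Abf.
  have einv : 0 < e^-1 by rewrite invr_gt0.
  have := ler_norm (pairing (y - a) g).
  by move: sn; rewrite /s !pairingBr !pairingBl; lra.
have [n nd] : exists n, ~ dense (~` F n).
  apply/existsNP => H.
  have /(_ _ domA (open_interior _)) [y [/interior_subset/domF[n Fny]]] :
      dense (\bigcap_n ~` F n).
    by apply: Baire => n; split; [exact: closed_openC|exact: H].
  by move=> /(_ n I).
have [O [[x0 Ox0] [oO OF]]] : exists O, O !=set0 /\ open O /\ O `<=` F n.
  move: nd => /existsNP[O /not_implyP[O0 /not_implyP[oO OF]]].
  exists O; do 2 split => //; move=> x Ox; apply: contrapT => nFx.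
  by apply: OF; exists x.
have /nbhs_ballP[d /= d0 dO] := open_nbhs_nbhs (conj oO Ox0).
exists x0, d, n.+1%:R^-1, n%:R; split=> //; first by rewrite invr_gt0 ltr0n.
by move=> y b f /dO/OF; exact.
Qed.

(** Boundedness on a ball of radius [d] around [x0], applied at the point
    [x0 + u] with [u = k *: (b - a)], gives
    [k * <b - a, f> <= c + <b - a, f> + <a - x0, f>].  The last term is close to
    [<a - x0, fs>], so a large factor [k] makes [<b - a, f>] small. *)
Lemma pairing_graph_near_le {R : realType} {X : completeNormedModType R}
    {A : X -> set (dual X)} (a : X) (fs : dual X) (e : R) :
  monotone A -> (dom A)° !=set0 -> 0 < e ->
  \forall p \near ((a, fs) : X * weak_star X),
    gra A p -> pairing (p.1 - a) p.2 <= e.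
Proof.
move=> monA domA e0.
have [x0 [d [r [c [d0 r0 bnd]]]]] := ball_pairing_bounded a monA domA.
pose C := `|c| + `|pairing (a - x0) fs| + 1.
have C0 : 0 < C by rewrite /C ltr_wpDl// addr_ge0.
(* The summand 1 of [k] absorbs the term [<b - a, f>] of the right-hand side. *)
pose k := 1 + C / e.
have k0 : 0 < k by rewrite addr_gt0 ?divr_gt0.
have near1 s : 0 < s -> \forall p \near ((a, fs) : X * weak_star X), ball a s p.1.
  move=> s0; apply: (@near_fst X (weak_star X) a fs (ball a s)).
  exact: nbhsx_ballx.
have near2 : \forall p \near ((a, fs) : X * weak_star X),
    `|pairing (a - x0) fs - pairing (a - x0) p.2| < 1.
  apply: (@near_snd X (weak_star X) a fs
    [set f | `|pairing (a - x0) fs - pairing (a - x0) f| < 1]).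
  exact: (cvgr_dist_lt _ _ (@weak_star_pairing_continuous _ _ (a - x0) fs) _ ltr01).
have dk0 : 0 < d / k by rewrite divr_gt0.
apply: filterS3 (near1 _ r0) (near1 _ dk0) near2.
move=> [b f] /= ab abk; rewrite ltr_norml => /andP[H1 _] Abf.
have x0u : ball x0 d (x0 + k *: (b - a)).
  rewrite -ball_normE /= opprD addNKr normrN normrZ gtr0_norm//.
  by move: abk; rewrite -ball_normE /= distrC ltr_pdivlMr// mulrC.
have := bnd _ _ _ x0u ab Abf.
set t := pairing (b - a) f.
rewrite pairingBl pairingDl pairingZl -/t => H2.
have tE : pairing b f = t + pairing a f by rewrite /t pairingBl subrK.
have Ct : C / e * t <= C.
  have := ler_norm c; have := ler_norm (pairing (a - x0) fs).
  move: H1 H2; rewrite tE /k mulrDl mul1r.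
  by move: (C / e * t) => q; rewrite /C !pairingBl; lra.
by move: Ct; rewrite mulrAC ler_pdivrMr// ler_pM2l.
Qed.

Theorem corollary3p4 (R : realType) (X : completeNormedModType R)
    (A : X -> set (dual X)) (hA : maximally_monotone A)
    (hdom : (dom A)° !=set0) :
  closed (gra A : set (X * weak_star X)).
Proof.
move=> [a fs] clA; have [monA _] := hA.
apply: maximally_monotone_related => // y g Ayg.
apply/ler_addgt0Pr => e e0; rewrite pairingBr !pairingBl.
have e30 : 0 < e / 3 by rewrite divr_gt0.
have near_f : \forall p \near ((a, fs) : X * weak_star X),
    `|pairing (a - y) fs - pairing (a - y) p.2| < e / 3.
  apply: (@near_snd X (weak_star X) a fs
    [set f | `|pairing (a - y) fs - pairing (a - y) f| < e / 3]).
  exact: (cvgr_dist_lt _ _ (@weak_star_pairing_continuous _ _ (a - y) fs) _ e30).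
have near_b : \forall p \near ((a, fs) : X * weak_star X),
    `|pairing a g - pairing p.1 g| < e / 3.
  apply: (@near_fst X (weak_star X) a fs
    [set b | `|pairing a g - pairing b g| < e / 3]).
  exact: (cvgr_dist_lt _ _ (pairing_continuous g a) _ e30).
have near_t := pairing_graph_near_le a fs _ monA hdom e30.
have [[b f] [Abf [/(_ Abf) /= Ht [Hf Hb]]]] :=
  clA _ (filterI near_t (filterI near_f near_b)).
move: Hf Hb => /=; rewrite !ltr_norml => /andP[Hf _] /andP[_ Hb].
have := monA _ _ _ _ Abf Ayg.
move: Ht Hf Hb; rewrite !pairingBr !pairingBl; lra.
Qed.
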